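(* The Carlitz module function $$C_s(t)=\sum_{k=0}^\infty f_k(s)t^{q^k},$$ where $f_k$ are the normalized Carlitz polynomials, belongs to $\mathcal F_2$ and is quasi-holonomic, jointly in both its variables $s,t$; that is, $d(M_f)=2$ for $f(s,t)=C_s(t)$.
   Context: Let $q$ be a power of a prime $p$, $K=\mathbb F_q((x))$ the field of formal Laurent series with its absolute value $|x|=q^{-1}$, and $\overline{K}_c$ the completion of an algebraic closure of $K$ with the extended absolute value. Put $[i]=x^{q^i}-x$ ($i\ge1$), $D_i=[i][i-1]^q\cdots[1]^{q^{i-1}}$ ($i\ge 1$), $D_0=1$. The normalized Carlitz polynomials are $f_0(s)=s$ and, for $k\ge1$, $$f_k(s)=D_k^{-1}\prod_{m\in\mathbb F_q[x],\ \deg m<k}(s-m)$$ (the product includes $m=0$). They are $\mathbb F_q$-linear polynomials of degree $q^k$. $\mathcal F_2$ is the set of germs at the origin of functions $f(s,t)=\sum_{k=0}^\infty\sum_{m=0}^ka_{m,k}s^{q^m}t^{q^k}$, $a_{m,k}\in\overline{K}_c$, convergent on some neighbourhood of the origin. The Carlitz ring $\mathfrak A_2$ is the ring of operators on $\mathcal F_2$ generated by the multiplications by scalars from $\overline{K}_c$ and the operators $\tau f=f^q$, $d_sf(s,t)=\bigl(f(xs,t)-xf(s,t)\bigr)^{1/q}$, $\Delta_tf(s,t)=f(s,xt)-xf(s,t)$. Every element of $\mathfrak A_2$ is a finite sum $\sum c_{l,\mu,i}\tau^ld_s^\mu\Delta_t^i$ with $c_{l,\mu,i}\in\overline{K}_c$.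 For $0\ne f\in\mathcal F_2$ let $I_f=\{\varphi\in\mathfrak A_2:\varphi(f)=0\}$ and $M_f=\mathfrak A_2/I_f\cong\mathfrak A_2f$. Let $\mathfrak M_j$ be the $\overline{K}_c$-span of the elements $\tau^ld_s^\mu\Delta_t^if$ with $l+\mu+i\le j$. There is a polynomial $\chi\in\mathbb Q[t]$ with $\dim_{\overline{K}_c}\mathfrak M_j=\chi(j)$ for all large $j$, and $d(M_f)=\deg\chi$. The function $f\in\mathcal F_2$ is called quasi-holonomic if $d(M_f)=2$. *)

(* Defs.v *)
From HB Require Import structures.
From mathcomp Require Import all_boot all_order all_algebra.
From mathcomp Require Import all_classical all_reals all_analysis.
From mathcomp Require Import ring.

Set Implicit Arguments.
Unset Strict Implicit.
Unset Printing Implicit Defensive.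

Import Order.TTheory GRing.Theory Num.Theory.
Import numFieldNormedType.Exports.

Local Open Scope classical_set_scope.
Local Open Scope ring_scope.

Definition vanish_below (F : fieldType) (a : int -> F) (N : int) : Prop :=
  forall n : int, n < N -> a n = 0.

Record laurent (F : fieldType) := Laurent {
  lcoef :> int -> F;
  lcoefP : exists N, vanish_below lcoef N }.

HB.instance Definition _ (F : fieldType) := gen_eqMixin (laurent F).
HB.instance Definition _ (F : fieldType) := gen_choiceMixin (laurent F).

Lemma laurentP (F : fieldType) (a b : laurent F) :
  (forall n, a n = b n) -> a = b.
Proof.
case: a b => [a Pa] [b Pb] /= /funext eab.
by move: Pa; rewrite eab => Pa; congr Laurent; exact: Prop_irrelevance.
Qed.

Lemma vanish_below_le (F : fieldType) (a : int -> F) (N M : int) :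
  M <= N -> vanish_below a N -> vanish_below a M.
Proof. by move=> MN aN n nM; apply: aN; exact: lt_le_trans MN. Qed.

Fact laurent0_subproof (F : fieldType) :
  exists N, vanish_below (fun _ : int => 0 : F) N.
Proof. by exists 0. Qed.

Definition laurent0 (F : fieldType) := Laurent (laurent0_subproof F).

Fact laurentN_subproof (F : fieldType) (a : laurent F) :
  exists N, vanish_below (fun n => - a n) N.
Proof. by case: (lcoefP a) => N aN; exists N => n /aN ->; rewrite oppr0. Qed.

Definition laurentN (F : fieldType) (a : laurent F) :=
  Laurent (laurentN_subproof a).

Fact laurentD_subproof (F : fieldType) (a b : laurent F) :
  exists N, vanish_below (fun n => a n + b n) N.
Proof.
case: (lcoefP a) (lcoefP b) => N aN [M bM]; exists (Num.min N M) => n.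
by rewrite lt_min => /andP[/aN -> /bM ->]; rewrite addr0.
Qed.

Definition laurentD (F : fieldType) (a b : laurent F) :=
  Laurent (laurentD_subproof a b).

(* The sum defining a coefficient of a product has finite support. *)
Definition laurent_conv (F : fieldType) (a b : int -> F) (n : int) : F :=
  \sum_(i \in [set: int]) a i * b (n - i).

Lemma laurent_conv_shift (F : fieldType) (a b : int -> F) (N M : int) :
  vanish_below a N -> vanish_below b M ->
  forall k : nat, laurent_conv a b (N + M + k%:Z) =
    \sum_(i < k.+1) a (N + i%:Z) * b (M + (k - i)%N%:Z).
Proof.
move=> aN bM k; rewrite /laurent_conv.
pose h (i : nat) : int := N + i%:Z.
rewrite -(@fsbig_widen _ _ _ _ (h @` `I_k.+1) setT) //; last first.
  move=> i [_ /= notP]; case: (ltP i N) => [/aN->|Ni]; first by rewrite mul0r.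
  rewrite [b _]bM ?mulr0 //; case: (ltP (N + k%:Z) i) => [lki|lik].
    by rewrite ltrBlDl addrAC ltrD2r.
  exfalso; apply: notP; exists (absz (i - N)).
    by rewrite /= ltnS -lez_nat gez0_abs ?subr_ge0 // lerBlDl.
  by rewrite /h gez0_abs ?subr_ge0 // addrCA subrr addr0.
rewrite fsbig_image; last by move=> i j _ _ /addrI[].
rewrite -fsbig_ord; apply: eq_bigr => i _; congr (_ * b _).
have ik : (i <= k)%N by rewrite -ltnS.
by rewrite /h -subzn //; ring.
Qed.

Lemma laurent_conv_vanish (F : fieldType) (a b : int -> F) (N M : int) :
  vanish_below a N -> vanish_below b M ->
  vanish_below (laurent_conv a b) (N + M).
Proof.
move=> aN bM n nNM; apply: fsbig1 => i _.
case: (ltP i N) => [/aN->|Ni]; first by rewrite mul0r.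
rewrite [b _]bM ?mulr0 // ltrBlDl; apply: lt_le_trans nNM _.
by rewrite lerD2r.
Qed.

Fact laurentM_subproof (F : fieldType) (a b : laurent F) :
  exists N, vanish_below (laurent_conv a b) N.
Proof.
case: (lcoefP a) (lcoefP b) => N aN [M bM]; exists (N + M).
exact: laurent_conv_vanish.
Qed.

Definition laurentM (F : fieldType) (a b : laurent F) :=
  Laurent (laurentM_subproof a b).

Fact laurent_of_poly_subproof (F : fieldType) (p : {poly F}) :
  exists N, vanish_below (fun n : int => if 0 <= n then p`_(absz n) else 0) N.
Proof. by exists 0 => n; rewrite ltNge => /negbTE ->. Qed.

Definition laurent_of_poly (F : fieldType) (p : {poly F}) :=
  Laurent (laurent_of_poly_subproof p).

Definition laurent1 (F : fieldType) := laurent_of_poly (1 : {poly F}).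

Section LaurentField.
Context (F : fieldType).
Implicit Types a b c : laurent F.

Fact laurent_addA : associative (@laurentD F).
Proof. by move=> a b c; apply: laurentP => n /=; rewrite addrA. Qed.

Fact laurent_addC : commutative (@laurentD F).
Proof. by move=> a b; apply: laurentP => n /=; rewrite addrC. Qed.

Fact laurent_add0 : left_id (laurent0 F) (@laurentD F).
Proof. by move=> a; apply: laurentP => n /=; rewrite add0r. Qed.

Fact laurent_addN : left_inverse (laurent0 F) (@laurentN F) (@laurentD F).
Proof. by move=> a; apply: laurentP => n /=; rewrite addNr. Qed.

HB.instance Definition _ := GRing.isZmodule.Build (laurent F)
  laurent_addA laurent_addC laurent_add0 laurent_addN.

(* Truncated shifted series: products are computed on polynomials. *)
Let tr (N : int) (m : nat) (a : int -> F) : {poly F} :=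
  \poly_(i < m) a (N + i%:Z).

Let coef_conv (a b : int -> F) (N M : int) (k m : nat) :
  vanish_below a N -> vanish_below b M -> (k < m)%N ->
  laurent_conv a b (N + M + k%:Z) = (tr N m a * tr M m b)`_k.
Proof.
move=> aN bM km; rewrite laurent_conv_shift // coefM.
apply: eq_bigr => i _; rewrite !coef_poly.
rewrite (leq_trans (ltn_ord i) km).
by rewrite (leq_ltn_trans (leq_subr _ _) km).
Qed.

Let eq_shift (a b : int -> F) (N : int) :
  vanish_below a N -> vanish_below b N ->
  (forall k : nat, a (N + k%:Z) = b (N + k%:Z)) -> forall n, a n = b n.
Proof.
move=> aN bN e n; case: (ltP n N) => [nN|Nn]; first by rewrite aN ?bN.
have -> : n = N + (absz (n - N))%:Z by rewrite gez0_abs ?subr_ge0 // addrCA subrr addr0.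
exact: e.
Qed.

Let eq_coefMl (p p' r : {poly F}) (m : nat) :
  (forall i, (i < m)%N -> p`_i = p'`_i) ->
  forall k, (k < m)%N -> (p * r)`_k = (p' * r)`_k.
Proof.
move=> e k km; rewrite !coefM; apply: eq_bigr => i _; rewrite e //.
by apply: leq_trans km; exact: ltn_ord.
Qed.

Fact laurent_mulC : commutative (@laurentM F).
Proof.
move=> a b; apply: laurentP => /=.
case: (lcoefP a) (lcoefP b) => N aN [M bM].
apply: (@eq_shift _ _ (N + M)) => [||k].
- exact: laurent_conv_vanish.
- by rewrite addrC; exact: laurent_conv_vanish.
rewrite (coef_conv aN bM (ltnSn k)) mulrC.
by rewrite [in RHS](addrC N) (coef_conv bM aN (ltnSn k)).
Qed.

Fact laurent_mulA : associative (@laurentM F).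
Proof.
move=> a b c; apply: laurentP => /=.
case: (lcoefP a) (lcoefP b) (lcoefP c) => N aN [M bM] [P cP].
have abV := laurent_conv_vanish aN bM; have bcV := laurent_conv_vanish bM cP.
apply: (@eq_shift _ _ (N + M + P)) => [||k].
- by rewrite -addrA; exact: laurent_conv_vanish.
- exact: laurent_conv_vanish.
rewrite [in RHS](coef_conv abV cP (ltnSn k)).
rewrite -[in LHS](addrA N) (coef_conv aN bcV (ltnSn k)).
transitivity ((tr N k.+1 a * tr M k.+1 b * tr P k.+1 c)`_k).
  rewrite -mulrA ![_ * (_ * _)]mulrC ![tr N _ _ * _]mulrC.
  apply: eq_coefMl (ltnSn k) => i ik.
  by rewrite coef_poly ik (coef_conv bM cP ik).
apply: eq_coefMl (ltnSn k) => i ik.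
by rewrite coef_poly ik (coef_conv aN bM ik).
Qed.

Fact vanish_laurent1 : vanish_below (laurent1 F) 0.
Proof. by move=> n /=; rewrite ltNge => /negbTE ->. Qed.

Fact laurent_mul1 : left_id (laurent1 F) (@laurentM F).
Proof.
move=> a; apply: laurentP => /=; case: (lcoefP a) => N aN.
apply: (@eq_shift _ _ (0 + N)) => [||k].
- exact: laurent_conv_vanish vanish_laurent1 aN.
- by rewrite add0r.
rewrite (coef_conv vanish_laurent1 aN (ltnSn k)).
have -> : tr 0 k.+1 (laurent1 F) = 1.
  apply/polyP => -[|i]; rewrite coef_poly ?coef1 //= ?coef1 //.
  by rewrite ?if_same.
by rewrite mul1r coef_poly ltnSn add0r.
Qed.

Fact laurent_mulDl : left_distributive (@laurentM F) (@laurentD F).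
Proof.
move=> a b c; apply: laurentP => /=.
case: (lcoefP a) (lcoefP b) (lcoefP c) => N0 aN0 [N1 bN1] [P cP].
pose N := Num.min N0 N1.
have aN : vanish_below a N by apply: vanish_below_le aN0; rewrite ge_min lexx.
have bN : vanish_below b N.
  by apply: vanish_below_le bN1; rewrite ge_min lexx orbT.
have dN : vanish_below (laurentD a b) N.
  by move=> n nN /=; rewrite aN ?bN ?addr0.
apply: (@eq_shift _ _ (N + P)) => [||k].
- exact: laurent_conv_vanish.
- by move=> n nN; rewrite !(laurent_conv_vanish _ cP nN) ?addr0.
rewrite !laurent_conv_shift // -big_split; apply: eq_bigr => i _ /=.
by rewrite mulrDl.
Qed.

Fact laurent_oner_neq0 : laurent1 F != 0.
Proof.
apply/eqP => /(congr1 (fun a : laurent F => a 0)) /= /eqP.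
by rewrite coef1 oner_eq0.
Qed.

HB.instance Definition _ := GRing.Zmodule_isComNzRing.Build (laurent F)
  laurent_mulA laurent_mulC laurent_mul1 laurent_mulDl laurent_oner_neq0.

Definition is_order (a : laurent F) (v : int) : Prop :=
  a v != 0 /\ vanish_below a v.

Lemma is_order_exists a : a != 0 -> exists v, is_order a v.
Proof.
move=> a0; case: (lcoefP a) => N aN.
have ex : exists k : nat, a (N + k%:Z) != 0.
  apply/not_existsP => e; move/eqP: a0; apply; apply: laurentP.
  apply: (eq_shift aN) => // k; apply/eqP; apply/negPn/negP; exact: e.
pose k := ex_minn ex; exists (N + k%:Z).
rewrite /k; case: ex_minnP => m am mmin; split=> // n nm.
case: (ltP n N) => [/aN//|Nn].
have en : n = N + (absz (n - N))%:Z by rewrite gez0_abs ?subr_ge0 // addrCA subrr addr0.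
apply/eqP/negPn/negP; rewrite en => /mmin.
rewrite leqNgt => /negP; apply; rewrite -ltz_nat gez0_abs ?subr_ge0 //.
by rewrite ltrBlDl.
Qed.

Let psinv (u : nat -> F) : {b : nat -> F |
  forall k, \sum_(i < k.+1) u i * b (k - i)%N = (u 0%N != 0)%:R * (k == 0)%:R}.
Proof.
pose nxt (s : seq F) : F := (u 0%N)^-1 *
  ((size s == 0)%:R - \sum_(i < size s) u i.+1 * s`_(size s - i.+1)%N).
pose L := fix L n := if n is m.+1 then rcons (L m) (nxt (L m)) else [::].
have sL n : size (L n) = n by elim: n => //= n IH; rewrite size_rcons IH.
have nL m n : (m < n)%N -> (L n)`_m = nxt (L m).
  elim: n => // n IH; rewrite ltnS leq_eqVlt => /orP[/eqP->|mn] /=.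
    by rewrite nth_rcons sL ltnn eqxx.
  by rewrite nth_rcons sL mn IH.
case: (eqVneq (u 0%N) 0) => u0.
  by exists (fun=> 0) => k; rewrite mul0r big1 // => i _; rewrite mulr0.
exists (fun n => nxt (L n)) => k; rewrite mul1r big_ord_recl subn0.
rewrite {1}/nxt sL mulVKf //.
rewrite [X in _ + X](eq_bigr (fun i : 'I_k => u i.+1 * (L k)`_(k - i.+1)%N)).
  by rewrite subrK.
by move=> i _; rewrite nL // -subn_gt0 subKn.
Qed.

Fact laurent_inv_exists a : a != 0 -> exists b, b * a = 1.
Proof.
move=> /is_order_exists[v [av aV]].
have [b bP] := psinv (fun k => a (v + k%:Z)).
have bV : vanish_below
    (fun n : int => if 0 <= n + v then b (absz (n + v)) else 0) (- v).
  by move=> n; rewrite -subr_lt0 opprK ltNge => /negbTE ->.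
exists (Laurent (ex_intro _ _ bV)); rewrite mulrC; apply: laurentP => /=.
apply: (@eq_shift _ _ (v - v)) => [||k].
- exact: laurent_conv_vanish.
- by rewrite subrr; exact: vanish_laurent1.
rewrite (laurent_conv_shift aV bV) subrr add0r /= coef1.
have := bP k; rewrite addr0 av mul1r => <-.
by apply: eq_bigr => i _; rewrite addrAC addNr add0r.
Qed.

Definition laurentV (a : laurent F) : laurent F :=
  if a == 0 then 0 else xget 0 [set b | b * a = 1].

Fact laurent_mulVf a : a != 0 -> laurentV a * a = 1.
Proof.
move=> a0; rewrite /laurentV (negbTE a0).
exact: (xgetPex 0 (laurent_inv_exists a0)).
Qed.

Fact laurent_inv0 : laurentV 0 = 0.
Proof. by rewrite /laurentV eqxx. Qed.

HB.instance Definition _ := GRing.ComNzRing_isField.Build (laurent F)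
  laurent_mulVf laurent_inv0.

End LaurentField.

Definition laurent_order (F : fieldType) (a : laurent F) : int :=
  xget 0 [set v | is_order a v].

(* F_q is given as an arbitrary finite field F, so q is #|F|; the absolute
   value is normalized by |x| = q^-1. *)
Definition laurent_abs (R : realType) (F : finFieldType) (a : laurent F) : R :=
  if a == 0 then 0 else (#|F|%:R : R) ^ (- laurent_order a).

Definition abs_cvg (R : realType) (C : fieldType) (absv : C -> R)
    (u : nat -> C) (l : C) : Prop :=
  (fun n => absv (u n - l)) @ \oo --> (0 : R).

Definition abs_cauchy (R : realType) (C : fieldType) (absv : C -> R)
    (u : nat -> C) : Prop :=
  forall e : R, 0 < e -> exists N : nat, forall m n : nat,
    (N <= m)%N -> (N <= n)%N -> absv (u m - u n) < e.

(* Algebraic closures of the uncountable field F_q((x)) are not constructed in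
   the library, so a completion of one is given with its universal data: an
   algebraically closed algebraic extension [cc_closure] of F_q((x)), densely
   embedded in a field that is complete for an absolute value extending the
   one of F_q((x)).  This determines the field up to isometric isomorphism. *)
Record completed_closure (R : realType) (F : finFieldType) := CompletedClosure {
  cc_closure : closedFieldType;
  cc_of_laurent : {rmorphism laurent F -> cc_closure};
  cc_field :> fieldType;
  cc_of_closure : {rmorphism cc_closure -> cc_field};
  cc_abs : cc_field -> R;
  cc_algebraic : forall z : cc_closure, algebraicOver cc_of_laurent z;
  cc_abs_ge0 : forall z, 0 <= cc_abs z;
  cc_abs_eq0 : forall z, cc_abs z = 0 -> z = 0;
  cc_absM : forall y z, cc_abs (y * z) = cc_abs y * cc_abs z;
  cc_absD : forall y z, cc_abs (y + z) <= Num.max (cc_abs y) (cc_abs z);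
  cc_abs_extends : forall a : laurent F,
    cc_abs (cc_of_closure (cc_of_laurent a)) = laurent_abs R a;
  cc_dense : forall (z : cc_field) (e : R), 0 < e ->
    exists y : cc_closure, cc_abs (z - cc_of_closure y) < e;
  cc_complete : forall u : nat -> cc_field,
    abs_cauchy cc_abs u -> exists l, abs_cvg cc_abs u l }.

(* The element of the completion given by a polynomial in F_q[x]. *)
Definition cc_poly (R : realType) (F : finFieldType)
    (C : completed_closure R F) (p : {poly F}) : C :=
  cc_of_closure C (cc_of_laurent C (laurent_of_poly p)).

Definition cc_x (R : realType) (F : finFieldType)
    (C : completed_closure R F) : C := cc_poly C 'X.

(* Junk value 0 when the series diverges. *)
Definition cc_series (R : realType) (F : finFieldType)
    (C : completed_closure R F) (u : nat -> C) : C :=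
  xget 0 [set l | abs_cvg (@cc_abs R F C) (fun n => \sum_(k < n) u k) l].

(* The q-th root; the field is perfect of characteristic p, so that it exists
   and is unique. *)
Definition cc_qroot (R : realType) (F : finFieldType)
    (C : completed_closure R F) (z : C) : C :=
  xget 0 [set w : C | w ^+ #|F| = z].

Definition carlitz_bracket (R : realType) (F : finFieldType)
    (C : completed_closure R F) (i : nat) : C :=
  cc_x C ^+ (#|F| ^ i) - cc_x C.

Definition carlitz_D (R : realType) (F : finFieldType)
    (C : completed_closure R F) (k : nat) : C :=
  \prod_(1 <= j < k.+1) carlitz_bracket C j ^+ (#|F| ^ (k - j)).

(* [{poly_k F}] is the finite type of polynomials of degree < k, including 0. *)
Definition carlitz_poly (R : realType) (F : finFieldType)
    (C : completed_closure R F) (k : nat) (s : C) : C :=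
  if k is 0%N then s
  else (carlitz_D C k)^-1 * \prod_(m : {poly_k F}) (s - cc_poly C m).

Definition carlitz_module (R : realType) (F : finFieldType)
    (C : completed_closure R F) (s t : C) : C :=
  cc_series (fun k => carlitz_poly k s * t ^+ (#|F| ^ k)).

(* A germ at the origin is represented by a function of two variables, up to
   the relation [germ_eq]. *)
Definition germ_eq (R : realType) (F : finFieldType)
    (C : completed_closure R F) (f g : C -> C -> C) : Prop :=
  exists2 r : R, 0 < r &
    forall s t : C, cc_abs s < r -> cc_abs t < r -> f s t = g s t.

Definition in_F2 (R : realType) (F : finFieldType)
    (C : completed_closure R F) (f : C -> C -> C) : Prop :=
  exists a : nat -> nat -> C, exists2 r : R, 0 < r &
    forall s t : C, cc_abs s < r -> cc_abs t < r ->
      abs_cvg (@cc_abs R F C)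
        (fun n => \sum_(k < n) \sum_(m < k.+1)
           a m k * s ^+ (#|F| ^ m) * t ^+ (#|F| ^ k))
        (f s t).

Definition op_tau (R : realType) (F : finFieldType)
    (C : completed_closure R F) (f : C -> C -> C) : C -> C -> C :=
  fun s t => f s t ^+ #|F|.

Definition op_ds (R : realType) (F : finFieldType)
    (C : completed_closure R F) (f : C -> C -> C) : C -> C -> C :=
  fun s t => cc_qroot (f (cc_x C * s) t - cc_x C * f s t).

Definition op_Deltat (R : realType) (F : finFieldType)
    (C : completed_closure R F) (f : C -> C -> C) : C -> C -> C :=
  fun s t => f s (cc_x C * t) - cc_x C * f s t.

Definition carlitz_monomial (R : realType) (F : finFieldType)
    (C : completed_closure R F) (l mu i : nat) (f : C -> C -> C) :
    C -> C -> C :=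
  iter l (@op_tau R F C) (iter mu (@op_ds R F C) (iter i (@op_Deltat R F C) f)).

(* The j-th term of the filtration of the module generated by f: the span of
   the tau^l d_s^mu Delta_t^i f with l + mu + i <= j, as a set of germs. *)
Definition filtration (R : realType) (F : finFieldType)
    (C : completed_closure R F) (f : C -> C -> C) (j : nat) :
    set (C -> C -> C) :=
  [set g | exists c : nat -> nat -> nat -> C,
     germ_eq g (fun s t =>
       \sum_(l < j.+1) \sum_(mu < j.+1) \sum_(i < j.+1 | (l + mu + i <= j)%N)
         c l mu i * carlitz_monomial l mu i f s t)].

(* The space of germs V has a basis with d elements. *)
Definition germ_dim (R : realType) (F : finFieldType)
    (C : completed_closure R F) (V : set (C -> C -> C)) (d : nat) : Prop :=
  exists b : 'I_d -> C -> C -> C,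
    [/\ forall i, V (b i),
        forall c : 'I_d -> C,
          germ_eq (fun s t => \sum_(i < d) c i * b i s t) (fun _ _ => 0) ->
          forall i, c i = 0
      & forall g, V g -> exists c : 'I_d -> C,
          germ_eq g (fun s t => \sum_(i < d) c i * b i s t)].

Definition hilbert_poly (R : realType) (F : finFieldType)
    (C : completed_closure R F) (f : C -> C -> C) (chi : {poly rat}) : Prop :=
  \forall j \near \oo,
    exists2 d : nat, germ_dim (filtration f j) d & chi.[j%:R] = d%:R.

(* d(M_f) = n; [size chi] is the degree plus one. *)
Definition module_dim (R : realType) (F : finFieldType)
    (C : completed_closure R F) (f : C -> C -> C) (n : nat) : Prop :=
  exists2 chi : {poly rat}, hilbert_poly f chi & size chi = n.+1.

Definition quasi_holonomic (R : realType) (F : finFieldType)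
    (C : completed_closure R F) (f : C -> C -> C) : Prop :=
  [/\ in_F2 f, ~ germ_eq f (fun _ _ => 0) & module_dim f 2].

(* Main.v *)
Require Import Defs.
From HB Require Import structures.
From mathcomp Require Import all_boot all_order all_algebra all_field.
From mathcomp Require Import all_classical all_reals all_analysis.
From mathcomp Require Import ring zify.

Set Implicit Arguments.
Unset Strict Implicit.
Unset Printing Implicit Defensive.

Import Order.TTheory GRing.Theory Num.Theory.
Import numFieldNormedType.Exports.

Local Open Scope classical_set_scope.
Local Open Scope ring_scope.

(** Write [f(s,t) = sum_k f_k(s) t^(q^k)] for the Carlitz module function,
    [D_k] for the Carlitz factorials and [[k] = x^(q^k) - x].

    The whole proof rests on the identity
    [f_(k+1)(xs) - x f_(k+1)(s) = f_k(s)^q] ([carlitz_poly_ds]), which,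
    together with [f_0(s) = s], says that [d_s f = f].  The operator [Delta_t] multiplies the coefficient of
    [t^(q^k)] by [[k]], so the same identity gives
    [d_s^mu Delta_t^i f = sum_k (x^(q^k) - x^(1/q^mu))^i f_k(s) t^(q^k)].
    Since [x^(q^k) - x^(1/q^mu)] differs from [[k]] by a constant, the binomial
    formula turns the right-hand side into a combination of the
    [Delta_t^i' f] with [i' <= i] ([iter_ds_Deltat],
    [carlitz_monomial_expand]).  Hence [d_s] contributes nothing to the
    filtration: its [j]-th term is spanned by the [tau^l Delta_t^i f] with
    [l + i <= j].

    These germs are linearly independent ([carlitz_monomials_free]).  In a
    relation with coefficients [c_(l,i)], the coefficient of [t^(q^n)] is
    [sum_l w_(l,n-l) f_(n-l)(s)^(q^l)], where
    [w_(l,k) = sum_i c_(l,i) [k]^(i q^l)].  It vanishes for all small [s].  As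
    [f_k] has a nonzero linear term, [f_(n-l)^(q^l)] starts in degree exactly
    [q^l], so that all [w_(l,k)] are zero.  For fixed [l], the polynomial with
    coefficients [c_(l,i)] then has the infinitely many roots [[k]^(q^l)].

    So the [j]-th term has dimension [(j+1)(j+2)/2], a polynomial of degree 2.
    Convergence comes from [|f_k(s)| <= 1/|D_k|] for [|s| <= 1] and
    [|D_k| >= |x|^(q^k - 1)]: on the bidisk [|s| <= 1], [|t| <= |x|^2] the
    [k]-th term of the series is at most [|x|^k] ([cc_abs_term]). *)

(** * Polynomials as Laurent series *)

Section LaurentOfPoly.
Context (F : fieldType).

Lemma laurent_of_polyB : zmod_morphism (@laurent_of_poly F).
Proof.
move=> p p'; apply: laurentP => n /=.
by case: ifP => _; rewrite ?coefB ?subrr.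
Qed.

Lemma laurent_of_polyM : monoid_morphism (@laurent_of_poly F).
Proof.
split=> // p p'; apply: laurentP => n.
have v0 (r : {poly F}) : vanish_below (laurent_of_poly r) 0.
  by move=> m /=; rewrite ltNge => /negbTE ->.
change (laurent_of_poly (p * p') n =
  laurent_conv (laurent_of_poly p) (laurent_of_poly p') n).
case: (ltP n 0) => [n0|n0].
  by rewrite (v0 _ _ n0) (laurent_conv_vanish (v0 p) (v0 p')) ?addr0.
case: n n0 => // k _.
rewrite -[X in laurent_conv _ _ X]add0r -[X in X + _]addr0.
rewrite laurent_conv_shift //; transitivity ((p * p')`_k) => //.
by rewrite coefM; apply: eq_bigr => i _; rewrite !add0r.
Qed.

HB.instance Definition _ := GRing.isZmodMorphism.Build
  {poly F} (laurent F) (@laurent_of_poly F) laurent_of_polyB.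
HB.instance Definition _ := GRing.isMonoidMorphism.Build
  {poly F} (laurent F) (@laurent_of_poly F) laurent_of_polyM.

Lemma laurent_order_eq (a : laurent F) (v : int) :
  is_order a v -> laurent_order a = v.
Proof.
move=> [av va]; rewrite /laurent_order; case: xgetP; last first.
  by move=> /(_ v) []; split.
move=> w _ [aw wa]; case: (ltgtP w v) => // [/va e|/wa e].
  by rewrite e eqxx in aw.
by rewrite e eqxx in av.
Qed.

End LaurentOfPoly.

(** * Frobenius and the absolute value *)

Section CompletedClosure.
Context (R : realType) (F : finFieldType) (C : completed_closure R F).
Implicit Types y z s t : C.

Local Notation q := #|F|.
Local Notation x := (cc_x C).
Local Notation "v[ z ]" := (cc_abs (z : C)) (at level 0, z at level 99, format "v[ z ]").

Lemma cc_polyB : zmod_morphism (@cc_poly R F C).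
Proof. by move=> p p'; rewrite /cc_poly !rmorphB. Qed.

Lemma cc_polyM : monoid_morphism (@cc_poly R F C).
Proof. by split=> [|p p']; rewrite /cc_poly ?rmorph1 ?rmorphM. Qed.

HB.instance Definition _ := GRing.isZmodMorphism.Build
  {poly F} C (@cc_poly R F C) cc_polyB.
HB.instance Definition _ := GRing.isMonoidMorphism.Build
  {poly F} C (@cc_poly R F C) cc_polyM.

Definition cc_const : F -> C := @cc_poly R F C \o polyC.
HB.instance Definition _ := GRing.RMorphism.on cc_const.

Lemma q_gt1 : (1 < q)%N.
Proof. exact: finNzRing_gt1. Qed.

Lemma q_gt0 : (0 < q)%N.
Proof. exact: ltnW q_gt1. Qed.

Lemma expq_gt0 k : (0 < q ^ k)%N.
Proof. by rewrite expn_gt0 q_gt0. Qed.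

(** The field [F] embeds in [C] through the constant polynomials, so the two
    characteristics agree. *)
Lemma pnat_card : [pchar C].-nat q.
Proof.
have [p p_pr pF] := finPcharP F.
have pC : p \in [pchar C] by exact: (rmorph_pchar cc_const pF).
have -> : q = (p ^ logn p q)%N := card_pprimeChar pF.
rewrite pnatX; apply/orP; left.
by rewrite pnatE.
Qed.

Lemma frobD k y z : (y + z) ^+ (q ^ k) = y ^+ (q ^ k) + z ^+ (q ^ k).
Proof. by rewrite exprDn_pchar // pnatX pnat_card. Qed.

Lemma frobN k y : (- y) ^+ (q ^ k) = - y ^+ (q ^ k).
Proof. by rewrite exprNn_pchar // pnatX pnat_card. Qed.

Lemma frobB k y z : (y - z) ^+ (q ^ k) = y ^+ (q ^ k) - z ^+ (q ^ k).
Proof. by rewrite frobD frobN. Qed.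

Lemma frobDq y z : (y + z) ^+ q = y ^+ q + z ^+ q.
Proof. by have := frobD 1 y z; rewrite expn1. Qed.

Lemma frobBq y z : (y - z) ^+ q = y ^+ q - z ^+ q.
Proof. by have := frobB 1 y z; rewrite expn1. Qed.

Lemma frob_sum k (I : Type) (r : seq I) (P : pred I) (u : I -> C) :
  (\sum_(i <- r | P i) u i) ^+ (q ^ k) = \sum_(i <- r | P i) u i ^+ (q ^ k).
Proof.
apply: (big_morph (fun z : C => z ^+ (q ^ k))) => [y z|]; first exact: frobD.
by rewrite expr0n gtn_eqF ?expq_gt0.
Qed.

Lemma frob_const (c : F) : cc_const c ^+ q = cc_const c.
Proof. by rewrite -rmorphXn expf_card. Qed.

Lemma frob_inj : injective (fun z : C => z ^+ q).
Proof.
move=> y z /= e; apply/eqP; rewrite -subr_eq0.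
by have := frobB 1 y z; rewrite expn1 e subrr => /eqP; rewrite expf_eq0 => /andP[].
Qed.

Lemma cc_qroot_eq y z : y ^+ q = z -> cc_qroot z = y.
Proof.
move=> yz; rewrite /cc_qroot; case: xgetP => [w _ /= wz|/(_ y)//].
by apply: frob_inj; rewrite wz.
Qed.

Lemma cc_absX z n : v[z ^+ n] = v[z] ^+ n.
Proof.
elim: n => [|n IH]; last by rewrite !exprS cc_absM IH.
have := cc_absM (1 : C) 1; rewrite mulr1 expr0 => e.
have : v[1] * (v[1] - 1) = 0 by rewrite mulrBr mulr1 -e subrr.
move/eqP; rewrite mulf_eq0 subr_eq0 => /orP[/eqP/cc_abs_eq0/eqP|/eqP//].
by rewrite oner_eq0.
Qed.

Lemma cc_abs1 : v[1] = 1.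
Proof. by rewrite -(expr0 (1 : C)) cc_absX. Qed.

Lemma cc_abs0 : v[0] = 0.
Proof.
by have := cc_abs_extends C 0; rewrite !rmorph0 /laurent_abs eqxx.
Qed.

Lemma cc_absV z : v[z^-1] = v[z]^-1.
Proof.
have [->|z0] := eqVneq z 0; first by rewrite invr0 cc_abs0 invr0.
have e : v[z] * v[z^-1] = 1 by rewrite -cc_absM divff // cc_abs1.
have z0' : v[z] != 0 by apply: contra_eq_neq e => ->; rewrite mul0r eq_sym oner_eq0.
by rewrite -[RHS]mulr1 -e mulKf.
Qed.

Lemma cc_absN z : v[- z] = v[z].
Proof.
have e : v[-1] ^+ 2 = 1 by rewrite -cc_absX sqrrN expr1n cc_abs1.
rewrite -mulN1r cc_absM; move/eqP: e.
by rewrite sqrp_eq1 ?cc_abs_ge0 // => /eqP ->; rewrite mul1r.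
Qed.

Lemma cc_absB y z : v[y - z] <= Num.max v[y] v[z].
Proof. by rewrite -(cc_absN z) cc_absD. Qed.

Lemma cc_abs_gt0 z : (0 < v[z]) = (z != 0).
Proof.
rewrite lt_def cc_abs_ge0 andbT; congr (~~ _).
by apply/eqP/eqP => [/cc_abs_eq0|->]; rewrite ?cc_abs0.
Qed.

Lemma cc_absB_lt y z : v[z] < v[y] -> v[y - z] = v[y].
Proof.
move=> zy; apply/eqP; rewrite eq_le; apply/andP; split.
  by apply: le_trans (cc_absB _ _) _; rewrite ge_max lexx ltW.
have := cc_absD (y - z) z; rewrite subrK le_max => /orP[//|yz].
by have := le_lt_trans yz zy; rewrite ltxx.
Qed.

Lemma cc_abs_sum (I : Type) (r : seq I) (P : pred I) (u : I -> C) (B : R) :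
  0 <= B -> (forall i, P i -> v[u i] <= B) -> v[\sum_(i <- r | P i) u i] <= B.
Proof.
move=> B0 uB; apply: (big_ind (fun z => v[z] <= B)) => [|y z yB zB|//].
  by rewrite cc_abs0.
by apply: le_trans (cc_absD _ _) _; rewrite ge_max yB.
Qed.

Lemma cc_abs_x : v[x] = q%:R^-1.
Proof.
rewrite cc_abs_extends /laurent_abs.
have o : is_order (laurent_of_poly ('X : {poly F})) 1.
  split=> [|[[|n]|n] //= _]; first by rewrite /= coefX oner_eq0.
  by rewrite coefX.
case: eqP => [e|_]; last by rewrite (laurent_order_eq o).
by case: o; rewrite e /= eqxx.
Qed.

Lemma cc_abs_x_gt0 : 0 < v[x].
Proof. by rewrite cc_abs_x invr_gt0 ltr0n q_gt0. Qed.

Lemma cc_abs_x_lt1 : v[x] < 1.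
Proof. by rewrite cc_abs_x invf_lt1 ?ltr1n ?ltr0n ?q_gt1 ?q_gt0. Qed.

Lemma xpow_inj : injective (fun n : nat => x ^+ n).
Proof.
move=> m n /= /(congr1 (@cc_abs R F C)); rewrite !cc_absX.
by apply: ieexprIn; rewrite ?cc_abs_x_gt0 // lt_eqF ?cc_abs_x_lt1.
Qed.

(** The element [x^(1/q^mu)]. *)
Definition root_x (mu : nat) : C := iter mu (@cc_qroot R F C) x.

(** The junk value of [cc_qroot] never occurs here: the iterated roots of [x]
    exist in the algebraically closed subfield. *)
Lemma root_xS mu : root_x mu.+1 ^+ q = root_x mu.
Proof.
have rt (a : cc_closure C) : exists b, b ^+ q = a.
  have [b] := @solve_monicpoly _ q (fun i => if i == 0%N then a else 0) q_gt0.
  rewrite (bigD1 (Ordinal q_gt0)) //= mulr1 big1 => [|i i0]; last first.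
    by rewrite (_ : ((i : nat) == 0%N) = false) ?mul0r //; apply: negbTE.
  by rewrite addr0 => ?; exists b.
have [a ea] : exists a, cc_of_closure C a = root_x mu.
  elim: mu => [|mu [a ea]]; first by eexists.
  have [b eb] := rt a; exists b; apply/esym/cc_qroot_eq.
  by rewrite -rmorphXn eb.
have [b eb] := rt a.
by rewrite -ea -eb rmorphXn; congr (_ ^+ _); apply: cc_qroot_eq; rewrite -rmorphXn eb.
Qed.

End CompletedClosure.

(** * Carlitz polynomials *)

Section CarlitzPolynomials.
Context (R : realType) (F : finFieldType) (C : completed_closure R F).
Implicit Types y z s t : C.

Local Notation q := #|F|.
Local Notation x := (cc_x C).
Local Notation "v[ z ]" := (cc_abs (z : C)) (at level 0, z at level 99, format "v[ z ]").
Local Notation "[' k ]" := (carlitz_bracket C k) (at level 0, k at level 99, format "[' k ]").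
Local Notation D := (carlitz_D C).

(** The unnormalized Carlitz polynomial, denoted [E k] below. *)
Definition carlitz_prod (k : nat) s : C :=
  \prod_(m : {poly_k F}) (s - cc_poly C m).
Local Notation E := carlitz_prod.

(** This is [X^q - X = prod_(c : F) (X - c)] evaluated at [y / z] and
    multiplied by [z^q], when [z] is nonzero. *)
Lemma prod_const y z :
  \prod_(c : F) (y - cc_const C c * z) = y ^+ q - z ^+ q.-1 * y.
Proof.
have qS : q = q.-1.+1 by rewrite prednK ?q_gt0.
have [->|z0] := eqVneq z 0.
  rewrite expr0n gtn_eqF ?mul0r ?subr0; last by have := q_gt1 F; lia.
  rewrite (eq_bigr (fun=> y)) => [|c _]; last by rewrite mulr0 subr0.
  by rewrite prodr_const.
have e := congr1 (fun p => (map_poly (cc_const C) p).[y / z]) (finField_genPoly F).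
rewrite rmorphB /= map_polyXn map_polyX hornerD hornerN hornerXn hornerX in e.
rewrite rmorph_prod horner_prod /= in e.
rewrite (eq_bigr (fun c => (y / z - cc_const C c) * z)) => [|c _]; last first.
  by rewrite mulrBl divfK.
rewrite big_split prodr_const /=.
have -> : \prod_c (y / z - cc_const C c) = (y / z) ^+ q - y / z.
  rewrite e; apply: eq_bigr => c _.
  by rewrite rmorphB /= map_polyX map_polyC /= hornerXsubC.
have -> : z ^+ #|xpredT : {pred F}| = z ^+ q by [].
rewrite mulrBl -exprMn divfK //; congr (_ - _).
by rewrite {1}qS exprS mulrA divfK // mulrC.
Qed.

Lemma carlitz_prod0 s : E 0 s = s.
Proof.
have n0 (m : {poly_0 F}) : (m : {poly F}) = 0.
  by apply/eqP; rewrite -size_poly_leq0 size_npoly.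
rewrite /carlitz_prod (eq_bigr (fun=> s)) => [|m _].
  by rewrite prodr_const card_npoly.
by rewrite n0 rmorph0 subr0.
Qed.

(** Every polynomial of degree less than [k + 1] is [c X^k + m] with [m] of
    degree less than [k], in a unique way. *)
Lemma carlitz_prodS k s :
  E k.+1 s = \prod_(c : F) E k (s - cc_const C c * x ^+ k).
Proof.
rewrite /carlitz_prod pair_big /=.
pose h (p : F * {poly_k F}) : {poly_k.+1 F} := npolyp k.+1 (p.1 *: 'X^k + p.2).
have hE p : h p = p.1 *: 'X^k + p.2 :> {poly F}.
  apply: npolypK; apply: leq_trans (size_polyD _ _) _.
  rewrite geq_max (leq_trans (size_scale_leq _ _)) ?size_polyXn //=.
  by apply: leqW; exact: size_npoly.
rewrite (reindex h); last first.
  exists (fun m : {poly_k.+1 F} => (m`_k, npolyp k m)) => [[c m] _|m _] /=.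
    congr pair; first by rewrite hE coefD coefZ coefXn eqxx mulr1 big_coef_npoly ?addr0 //.
    apply/val_inj/polyP => i; rewrite /= coef_npolyp hE coefD coefZ coefXn /=.
    by case: ltnP => ik; rewrite ?(ltn_eqF ik) ?mulr0 ?add0r // big_coef_npoly.
  apply/val_inj/polyP => i; rewrite [LHS]/= hE coefD coefZ coefXn /= coef_npolyp.
  case: ltngtP => [ik|ki|->]; rewrite ?mulr0 ?mulr1 ?add0r ?addr0 //.
  by rewrite big_coef_npoly.
apply: eq_bigr => p _; rewrite hE rmorphD -mul_polyC rmorphM rmorphXn.
by rewrite opprD addrA.
Qed.

(** When [E k] is [F]-linear, [E k.+1] is the product over [c : F] of
    [E k s - c E k (x^k)], which [prod_const] computes; the resulting formula
    is again [F]-linear in [s]. *)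
Lemma carlitz_prod_linear k :
  [/\ forall y z, E k (y - z) = E k y - E k z,
      forall c z, E k (cc_const C c * z) = cc_const C c * E k z &
      forall s, E k.+1 s = E k s ^+ q - E k (x ^+ k) ^+ q.-1 * E k s].
Proof.
have step j : (forall y z, E j (y - z) = E j y - E j z) ->
    (forall c z, E j (cc_const C c * z) = cc_const C c * E j z) ->
    forall s, E j.+1 s = E j s ^+ q - E j (x ^+ j) ^+ q.-1 * E j s.
  move=> EB EZ s; rewrite carlitz_prodS -prod_const.
  by apply: eq_bigr => c _; rewrite EB EZ.
suff [EB EZ] : (forall y z, E k (y - z) = E k y - E k z) /\
    (forall c z, E k (cc_const C c * z) = cc_const C c * E k z).
  by split => //; exact: step.
elim: k => [|k [EB EZ]]; first by split=> *; rewrite !carlitz_prod0.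
split=> [y z|c z]; rewrite !(step _ EB EZ) ?EB ?EZ.
  by rewrite frobBq; ring.
by rewrite exprMn frob_const; ring.
Qed.

Lemma carlitz_bracketS k : [' k.+1] = [' k] ^+ q + (x ^+ q - x).
Proof.
by rewrite /carlitz_bracket frobBq -exprM -expnSr; ring.
Qed.

Lemma carlitz_DS k : D k.+1 = [' k.+1] * D k ^+ q.
Proof.
rewrite /carlitz_D big_nat_recr //= subnn expr1 mulrC -prodrXl.
congr (_ * _); apply: eq_big_nat => i /andP[_ ik].
by rewrite -exprM -expnSr subSn.
Qed.

(** The two facts are proved together: evaluating the first one at [s = x^k],
    a point where the recursion for [E k.+1] gives [0], yields
    [E k.+1 (x^(k+1)) = [k+1] D_k^q = D_(k+1)], and this value is what the next
    step of the first one needs. *)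
Lemma carlitz_prod_mulx k :
  (forall s, E k.+1 (x * s) = x * E k.+1 s + [' k.+1] * E k s ^+ q) /\
  E k (x ^+ k) = D k.
Proof.
have qS : q = q.-1.+1 by rewrite prednK ?q_gt0.
have rec j s : E j.+1 s = E j s ^+ q - E j (x ^+ j) ^+ q.-1 * E j s.
  by case: (carlitz_prod_linear j).
elim: k => [|k [IH IHD]].
  split=> [s|]; last by rewrite carlitz_prod0 /carlitz_D big_geq.
  rewrite !rec !carlitz_prod0 expr0 expr1n carlitz_bracketS /carlitz_bracket.
  rewrite expn0 expr1 subrr expr0n gtn_eqF ?q_gt0 // exprMn.
  by rewrite mulr0n; ring.
have ED : E k.+1 (x ^+ k.+1) = D k.+1.
  rewrite exprS IH IHD carlitz_DS rec IHD.
  by rewrite {1}qS exprSr subrr mulr0 add0r.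
split=> // s; rewrite (rec k.+1 s) (rec k.+1 (x * s)) ED IH frobDq !exprMn.
rewrite (carlitz_bracketS k.+1).
set b := [' k.+1]; set d := D k.+1 ^+ q.-1.
have db : d * b = b ^+ q * (D k ^+ q.-1) ^+ q.
  by rewrite /d carlitz_DS exprMn [in b ^+ q]qS exprSr -!exprM mulnC; ring.
have -> : E k.+1 s ^+ q = (E k s ^+ q) ^+ q - (D k ^+ q.-1) ^+ q * E k s ^+ q.
  by rewrite rec IHD frobBq exprMn.
(* The two sides differ by a multiple of the relation [db],
   since [[k+2] = [k+1]^q + x^q - x]. *)
ring: db.
Qed.

Lemma carlitz_prod_rec k s : E k.+1 s = E k s ^+ q - D k ^+ q.-1 * E k s.
Proof.
by case: (carlitz_prod_linear k) => _ _ ->; case: (carlitz_prod_mulx k) => _ ->.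
Qed.

Lemma cc_abs_bracket k : v[[' k.+1]] = v[x].
Proof.
rewrite /carlitz_bracket -cc_absN opprB cc_absB_lt // cc_absX.
rewrite -[X in _ < X]expr1 ltr_iXn2l ?cc_abs_x_gt0 ?cc_abs_x_lt1 //.
by rewrite -[X in (X < _)%N](expn0 q) ltn_exp2l ?q_gt1.
Qed.

Lemma cc_abs_D_le1 k : v[D k] <= 1.
Proof.
elim: k => [|k IH]; first by rewrite /carlitz_D big_geq // cc_abs1.
rewrite carlitz_DS cc_absM cc_absX cc_abs_bracket.
by rewrite mulr_ile1 ?cc_abs_ge0 ?exprn_ge0 ?exprn_ile1 ?cc_abs_ge0 // ltW ?cc_abs_x_lt1.
Qed.

(** By [carlitz_DS] the exact exponent is [1 + q + ... + q^(k-1)]; the cruder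
    bound suffices for convergence. *)
Lemma cc_abs_D_ge k : v[x] ^+ (q ^ k).-1 <= v[D k].
Proof.
have x0 := cc_abs_x_gt0 C; have x1 := cc_abs_x_lt1 C.
elim: k => [|k IH]; first by rewrite /carlitz_D big_geq // cc_abs1.
rewrite carlitz_DS cc_absM cc_absX cc_abs_bracket.
apply: (@le_trans _ _ (v[x] * (v[x] ^+ (q ^ k).-1) ^+ q)); last first.
  rewrite ler_pM2l //; apply: lerXn2r => //;
    by rewrite nnegrE ?exprn_ge0 ?cc_abs_ge0 // ltW.
rewrite -exprM -exprS ler_wiXn2l ?ltW //.
have := q_gt1 F; have := expq_gt0 F k; rewrite expnSr; nia.
Qed.

Lemma carlitz_D_neq0 k : D k != 0.
Proof.
rewrite -cc_abs_gt0; apply: lt_le_trans (cc_abs_D_ge k).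
by rewrite exprn_gt0 ?cc_abs_x_gt0.
Qed.

Lemma cc_abs_carlitz_prod k s : v[s] <= 1 -> v[E k s] <= 1.
Proof.
move=> s1; elim: k => [|k IH]; first by rewrite carlitz_prod0.
rewrite carlitz_prod_rec; apply: le_trans (cc_absB _ _) _.
rewrite ge_max cc_absM !cc_absX exprn_ile1 ?cc_abs_ge0 //=.
by rewrite mulr_ile1 ?exprn_ge0 ?exprn_ile1 ?cc_abs_ge0 ?cc_abs_D_le1.
Qed.

Lemma carlitz_polyE k s : carlitz_poly k s = (D k)^-1 * E k s.
Proof.
by case: k => //=; rewrite carlitz_prod0 /carlitz_D big_geq // invr1 mul1r.
Qed.

(** The identity behind [d_s f = f]. *)
Lemma carlitz_poly_ds k s :
  carlitz_poly k.+1 (x * s) - x * carlitz_poly k.+1 s = carlitz_poly k s ^+ q.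
Proof.
rewrite !carlitz_polyE (carlitz_prod_mulx k).1 carlitz_DS exprMn exprVn.
have b0 : [' k.+1] != 0 by rewrite -cc_abs_gt0 cc_abs_bracket cc_abs_x_gt0.
have d0 : D k ^+ q != 0 by rewrite expf_neq0 ?carlitz_D_neq0.
by field; rewrite b0 d0.
Qed.

Lemma carlitz_poly_coefs : exists a : nat -> nat -> C, forall k s,
  carlitz_poly k s = \sum_(m < k.+1) a m k * s ^+ (q ^ m).
Proof.
suff H k : exists a : nat -> C, forall s, E k s = \sum_(m < k.+1) a m * s ^+ (q ^ m).
  have [a aP] := choice H; exists (fun m k => (D k)^-1 * a k m) => k s.
  rewrite carlitz_polyE aP mulr_sumr.
  by apply: eq_bigr => m _; rewrite mulrA.
elim: k => [|k [a aP]].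
  by exists (fun=> 1) => s; rewrite carlitz_prod0 big_ord1 mul1r expn0 expr1.
exists (fun m => (if m is m'.+1 then a m' ^+ q else 0)
   - D k ^+ q.-1 * (if (m <= k)%N then a m else 0)) => s.
have fs := @frob_sum R F C 1; rewrite expn1 in fs.
rewrite carlitz_prod_rec aP fs.
under [RHS]eq_bigr do rewrite mulrBl.
rewrite sumrB; congr (_ - _).
  rewrite [RHS]big_ord_recl /= mul0r add0r; apply: eq_bigr => m _.
  by rewrite exprMn -exprM -expnSr.
rewrite [RHS]big_ord_recr /= ltnn mulr0 mul0r addr0 mulr_sumr.
by apply: eq_bigr => m _; rewrite -ltnS ltn_ord mulrA.
Qed.

(** The Carlitz polynomials have a nonzero linear term; this is what separates
    their Frobenius powers in a linear relation. *)
Lemma carlitz_poly_factor k : exists2 h : {poly C}, h.[0] != 0 &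
  forall s, carlitz_poly k s = s * h.[s].
Proof.
suff [h h0 hP] : exists2 h : {poly C}, h.[0] != 0 & forall s, E k s = s * h.[s].
  exists ((D k)^-1 *: h) => [|s]; rewrite ?carlitz_polyE hornerZ.
    by rewrite mulf_neq0 ?invr_eq0 ?carlitz_D_neq0.
  by rewrite hP; ring.
elim: k => [|k [h h0 hP]].
  by exists 1 => [|s]; rewrite hornerC ?oner_neq0 // carlitz_prod0 mulr1.
exists ('X^(q.-1) * h ^+ q - D k ^+ q.-1 *: h) => [|s].
  rewrite hornerD hornerN hornerM hornerZ hornerXn expr0n gtn_eqF; last first.
    by have := q_gt1 F; lia.
  by rewrite mul0r sub0r oppr_eq0 mulf_neq0 ?expf_neq0 ?carlitz_D_neq0.
have qS : q = q.-1.+1 by rewrite prednK ?q_gt0.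
rewrite carlitz_prod_rec hP hornerD hornerN hornerM hornerZ hornerXn horner_exp.
by rewrite exprMn {1}qS exprS; ring.
Qed.

(** The bound [|D_k| >= |x|^(q^k - 1)] costs [|x|^(1 - q^k)], against
    [|t|^(q^k) <= |x|^(2 q^k)], and [k <= q^k]. *)
Lemma cc_abs_term k s t : v[s] <= 1 -> v[t] <= v[x] ^+ 2 ->
  v[carlitz_poly k s * t ^+ (q ^ k)] <= v[x] ^+ k.
Proof.
have x0 := cc_abs_x_gt0 C; have x1 := cc_abs_x_lt1 C.
move=> s1 tx; rewrite carlitz_polyE !cc_absM cc_absV cc_absX.
rewrite -mulrA ler_pdivrMl ?cc_abs_gt0 ?carlitz_D_neq0 //.
apply: (@le_trans _ _ (v[x] ^+ 2 ^+ (q ^ k))).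
  rewrite -[X in _ <= X]mul1r ler_pM ?exprn_ge0 ?cc_abs_ge0 ?cc_abs_carlitz_prod //.
  by apply: lerXn2r => //; rewrite nnegrE ?exprn_ge0 ?cc_abs_ge0.
apply: (@le_trans _ _ (v[x] ^+ (q ^ k).-1 * v[x] ^+ k)); last first.
  by rewrite ler_pM2r ?exprn_gt0 ?cc_abs_D_ge.
rewrite -exprM -exprD ler_wiXn2l ?ltW //.
have : (k < q ^ k)%N by rewrite ltn_expl ?q_gt1.
by lia.
Qed.

End CarlitzPolynomials.

(** * Ultrametric convergence *)

Section Convergence.
Context (R : realType) (F : finFieldType) (C : completed_closure R F).
Implicit Types (y z s t l : C) (u w : nat -> C).

Local Notation q := #|F|.
Local Notation x := (cc_x C).
Local Notation "v[ z ]" := (cc_abs (z : C)) (at level 0, z at level 99, format "v[ z ]").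
Local Notation "u ~> l" := (abs_cvg (@cc_abs R F C) u l) (at level 70).

Lemma cc_cvgP u l : (u ~> l) <->
  forall e : R, 0 < e -> exists N, forall n, (N <= n)%N -> v[u n - l] < e.
Proof.
rewrite /abs_cvg; split=> [/cvgr0Pnorm_lt H e e0|H].
  have [N _ HN] := H e e0; exists N => n Nn.
  by have := HN n Nn; rewrite /= ger0_norm ?cc_abs_ge0.
apply/cvgr0Pnorm_lt => e e0; have [N HN] := H e e0.
by exists N => // n /= Nn; rewrite ger0_norm ?cc_abs_ge0 ?HN.
Qed.

Lemma xpow_small (e : R) : 0 < e -> exists N, forall n, (N <= n)%N -> v[x] ^+ n < e.
Proof.
move=> e0; have /cvgr0Pnorm_lt H : (GRing.exp v[x] : R ^nat) @ \oo --> (0 : R).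
  by apply: cvg_expr; rewrite ger0_norm ?cc_abs_ge0 ?cc_abs_x_lt1.
have [N _ HN] := H e e0; exists N => n Nn.
by have := HN n Nn; rewrite /= ger0_norm ?exprn_ge0 ?cc_abs_ge0.
Qed.

Lemma cc_cvg_ext u w l : (forall n, u n = w n) -> u ~> l -> w ~> l.
Proof. by move=> /funext ->. Qed.

Lemma cc_cvgD u w l z : u ~> l -> w ~> z -> (fun n => u n + w n) ~> (l + z).
Proof.
move=> /cc_cvgP ul /cc_cvgP wz; apply/cc_cvgP => e e0.
have [N uN] := ul e e0; have [M wM] := wz e e0.
exists (maxn N M) => n; rewrite geq_max => /andP[/uN un /wM wn].
rewrite opprD addrACA; apply: le_lt_trans (cc_absD _ _) _.
by rewrite gt_max un.
Qed.

Lemma cc_cvgZ c u l : u ~> l -> (fun n => c * u n) ~> (c * l).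
Proof.
move=> /cc_cvgP ul; apply/cc_cvgP => e e0.
have c0 : 0 < v[c] + 1 by apply: ltr_wpDl; rewrite ?cc_abs_ge0.
have [N uN] := ul (e / (v[c] + 1)) (divr_gt0 e0 c0).
exists N => n /uN un; rewrite -mulrBr cc_absM.
rewrite ltr_pdivlMr // mulrC in un; apply: le_lt_trans un.
by rewrite ler_wpM2r ?cc_abs_ge0 // lerDl.
Qed.

Lemma cc_cvgB u w l z : u ~> l -> w ~> z -> (fun n => u n - w n) ~> (l - z).
Proof.
move=> ul /(cc_cvgZ (-1)) wz; rewrite -mulN1r; apply: cc_cvg_ext (cc_cvgD ul wz).
by move=> n /=; rewrite mulN1r.
Qed.

Lemma cc_cvg_cst l : (fun=> l) ~> l.
Proof. by apply/cc_cvgP => e e0; exists 0%N => n _; rewrite subrr cc_abs0. Qed.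

Lemma cc_cvg_sum (I : Type) (r : seq I) (P : pred I) (u : I -> nat -> C) (l : I -> C) :
  (forall i, P i -> u i ~> l i) ->
  (fun n => \sum_(i <- r | P i) u i n) ~> (\sum_(i <- r | P i) l i).
Proof.
move=> ul; elim: r => [|i r IH].
  by rewrite big_nil; apply: cc_cvg_ext (cc_cvg_cst 0) => n; rewrite big_nil.
rewrite big_cons; case: ifPn => Pi.
  by apply: cc_cvg_ext (cc_cvgD (ul i Pi) IH) => n; rewrite big_cons Pi.
by apply: cc_cvg_ext IH => n; rewrite big_cons (negbTE Pi).
Qed.

Lemma cc_cvg_frob k u l : u ~> l -> (fun n => u n ^+ (q ^ k)) ~> (l ^+ (q ^ k)).
Proof.
move=> /cc_cvgP ul; apply/cc_cvgP => e e0.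
have m0 : 0 < Num.min 1 e by rewrite lt_min ltr01.
have [N uN] := ul _ m0.
exists N => n /uN; rewrite -frobB cc_absX lt_min => /andP[u1 ue].
apply: le_lt_trans ue; rewrite -[X in _ <= X]expr1.
by rewrite ler_wiXn2l ?cc_abs_ge0 ?expq_gt0 // ltW.
Qed.

Lemma cc_cvg_shift k u l : (fun n => u (n + k)%N) ~> l <-> u ~> l.
Proof.
split=> /cc_cvgP ul; apply/cc_cvgP => e /ul[N uN].
  exists (N + k)%N => n Nn.
  have kn : (k <= n)%N by apply: leq_trans Nn; rewrite leq_addl.
  by rewrite -(subnK kn); apply: uN; rewrite leq_subRL // addnC.
by exists N => n Nn; apply: uN; rewrite (leq_trans Nn) ?leq_addr.
Qed.

Lemma cc_cvg_unique u l z : u ~> l -> u ~> z -> l = z.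
Proof.
move=> ul uz; have /cc_cvgP H := cc_cvgB ul uz.
apply/eqP; rewrite -subr_eq0; apply/negPn/negP; rewrite -cc_abs_gt0 => /H[N].
by move=> /(_ N (leqnn N)); rewrite subrr sub0r cc_absN ltxx.
Qed.

(** The partial sums are Cauchy by the ultrametric inequality, so [cc_series]
    takes its proper value. *)
Lemma cc_series_geometric u : (forall k, v[u k] <= v[x] ^+ k) ->
  (fun n => \sum_(k < n) u k) ~> cc_series u.
Proof.
move=> ux; rewrite /cc_series; case: xgetP => [l _ //|]; last move=> H.
have [l Hl] : exists l, (fun n => \sum_(k < n) u k) ~> l; last by case: (H l).
have ge m n : (m <= n)%N -> v[\sum_(k < n) u k - \sum_(k < m) u k] <= v[x] ^+ m.
  move=> mn; rewrite -!(big_mkord xpredT) (big_cat_nat (n := m)) //= addrAC subrr add0r.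
  rewrite big_nat_cond; apply: cc_abs_sum => [|k]; first by rewrite exprn_ge0 ?cc_abs_ge0.
  rewrite andbT => /andP[mk _]; apply: le_trans (ux k) _.
  by rewrite ler_wiXn2l ?cc_abs_ge0 // ltW ?cc_abs_x_lt1.
apply: cc_complete => e /xpow_small[N HN]; exists N => m n Nm Nn.
have [mn|/ltnW nm] := leqP m n; last by apply: le_lt_trans (ge _ _ nm) (HN _ Nn).
by rewrite -cc_absN opprB; apply: le_lt_trans (ge _ _ mn) (HN _ Nm).
Qed.

End Convergence.

(** * The operators on the Carlitz module function *)

Section CarlitzModule.
Context (R : realType) (F : finFieldType) (C : completed_closure R F).
Implicit Types (y z s t l : C) (u w : nat -> C).

Local Notation q := #|F|.
Local Notation x := (cc_x C).
Local Notation "v[ z ]" := (cc_abs (z : C)) (at level 0, z at level 99, format "v[ z ]").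
Local Notation "[' k ]" := (carlitz_bracket C k) (at level 0, k at level 99, format "[' k ]").
Local Notation "u ~> l" := (abs_cvg (@cc_abs R F C) u l) (at level 70).
Local Notation f := (@carlitz_module R F C).

(** The region where every series below converges; it is stable under
    multiplication of either variable by [x], so that all identities between
    operators can be checked on it pointwise. *)
Definition in_bidisk s t : Prop := v[s] <= 1 /\ v[t] <= v[x] ^+ 2.

Lemma cc_abs_xM z : v[x * z] <= v[z].
Proof. by rewrite cc_absM ler_piMl ?cc_abs_ge0 // ltW ?cc_abs_x_lt1. Qed.

Lemma in_bidisk_xl s t : in_bidisk s t -> in_bidisk (x * s) t.
Proof. by case=> s1 t1; split=> //; apply: le_trans (cc_abs_xM _) s1. Qed.

Lemma in_bidisk_xr s t : in_bidisk s t -> in_bidisk s (x * t).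
Proof. by case=> s1 t1; split=> //; apply: le_trans (cc_abs_xM _) t1. Qed.

Lemma in_bidisk_small s t :
  v[s] < v[x] ^+ 2 -> v[t] < v[x] ^+ 2 -> in_bidisk s t.
Proof.
move=> s1 t1; split; last exact: ltW.
by apply: le_trans (ltW s1) _; rewrite exprn_ile1 ?cc_abs_ge0 // ltW ?cc_abs_x_lt1.
Qed.

(** Partial sums of [f] with the [k]-th term multiplied by [w k]. *)
Definition weighted w s t (n : nat) : C :=
  \sum_(k < n) w k * (carlitz_poly k s * t ^+ (q ^ k)).

Lemma cvg_carlitz_module s t : in_bidisk s t -> weighted (fun=> 1) s t ~> f s t.
Proof.
move=> [s1 t1].
apply: cc_cvg_ext (cc_series_geometric (fun k => cc_abs_term k s1 t1)) => n.
by apply: eq_bigr => k _; rewrite mul1r.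
Qed.

Lemma carlitz_module_F2 : in_F2 f.
Proof.
have [a aP] := carlitz_poly_coefs C.
exists a, (v[x] ^+ 2) => [|s t s1 t1]; first by rewrite exprn_gt0 ?cc_abs_x_gt0.
apply: cc_cvg_ext (cvg_carlitz_module (in_bidisk_small s1 t1)) => n.
by apply: eq_bigr => k _; rewrite mul1r aP mulr_suml.
Qed.

Local Notation g i := (iter i (@op_Deltat R F C) f).

Lemma cvg_Deltat i s t : in_bidisk s t ->
  weighted (fun k => [' k] ^+ i) s t ~> g i s t.
Proof.
elim: i s t => [|i IH] s t st /=; first exact: cvg_carlitz_module.
rewrite /op_Deltat.
have H := cc_cvgB (IH _ _ (in_bidisk_xr st)) (cc_cvgZ x (IH _ _ st)).
apply: cc_cvg_ext H => n.
rewrite /weighted mulr_sumr -sumrB; apply: eq_bigr => k _.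
by rewrite exprS exprMn /carlitz_bracket; ring.
Qed.

(** The binomial expansion of [(Delta_t + (x - y))^i f]. *)
Definition shifted_Deltat y (i : nat) s t : C :=
  \sum_(j < i.+1) ((x - y) ^+ (i - j) *+ 'C(i, j)) * g j s t.

(** Here [x^(q^k) - y] is [(x - y) + [k]], and [Delta_t^j] has weights [[k]^j]. *)
Lemma cvg_shifted_Deltat y i s t : in_bidisk s t ->
  weighted (fun k => (x ^+ (q ^ k) - y) ^+ i) s t ~> shifted_Deltat y i s t.
Proof.
move=> st.
have H : (fun n => \sum_(j < i.+1) ((x - y) ^+ (i - j) *+ 'C(i, j)) *
    weighted (fun k => [' k] ^+ j) s t n) ~> shifted_Deltat y i s t.
  by apply: cc_cvg_sum => j _; apply: cc_cvgZ; exact: cvg_Deltat.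
apply: cc_cvg_ext H => n; rewrite /weighted.
under eq_bigr do rewrite mulr_sumr.
rewrite exchange_big; apply: eq_bigr => k _ /=.
have -> : x ^+ (q ^ k) - y = (x - y) + [' k] by rewrite /carlitz_bracket; ring.
rewrite exprDn mulr_suml; apply: eq_bigr => j _.
by rewrite mulrA mulrnAl.
Qed.

(** If [u] has weights [w], then [u(xs,t) - x u(s,t)] has the series
    [sum_k w_(k+1) f_k(s)^q t^(q^(k+1))].  For [w_k = (x^(q^k) - y^q)^i] this is
    the [q]-th power of the series with weights [(x^(q^k) - y)^i]; so one
    application of [d_s] replaces [x^(1/q^mu)] by its [q]-th root. *)
Lemma iter_ds_Deltat mu i s t : in_bidisk s t ->
  iter mu (@op_ds R F C) (g i) s t = shifted_Deltat (root_x C mu) i s t.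
Proof.
elim: mu s t => [|mu IH] s t st.
  apply: cc_cvg_unique (cvg_Deltat i st) _.
  exact: cvg_shifted_Deltat.
rewrite /= /op_ds !IH //; last exact: in_bidisk_xl.
set y := root_x C mu.+1; apply: cc_qroot_eq.
apply: (@cc_cvg_unique _ _ _ (fun n =>
  weighted (fun k => (x ^+ (q ^ k) - y) ^+ i) s t n ^+ q)).
  by have := cc_cvg_frob 1 (cvg_shifted_Deltat y i st); rewrite expn1.
have H := cc_cvgB (cvg_shifted_Deltat (root_x C mu) i (in_bidisk_xl st))
  (cc_cvgZ x (cvg_shifted_Deltat (root_x C mu) i st)).
apply: cc_cvg_ext (proj2 (cc_cvg_shift 1 _ _) H) => n /=.
have fs := @frob_sum R F C 1; rewrite expn1 in fs.
rewrite /weighted fs mulr_sumr -sumrB addn1 big_ord_recl /=.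
(* The term of index 0 disappears because [f_0(s) = s]. *)
rewrite [X in X + _](_ : _ = 0); last first.
  by rewrite /= expn0 expr1 /=; ring.
rewrite add0r; apply: eq_bigr => k _; rewrite !exprMn exprAC frobBq root_xS.
rewrite -!(exprM _ (q ^ k)) -expnSr -carlitz_poly_ds /bump /= add1n.
by ring.
Qed.

Lemma carlitz_monomialE (l mu i : nat) s t :
  carlitz_monomial l mu i f s t = iter mu (@op_ds R F C) (g i) s t ^+ (q ^ l).
Proof.
rewrite /carlitz_monomial; elim: l => [|l IH] /=; first by rewrite expr1.
by rewrite /op_tau IH -exprM -expnSr.
Qed.

(** The powers of [d_s] are absorbed by lower powers of [Delta_t], with the
    same power of [tau]. *)
Lemma carlitz_monomial_expand (l mu i : nat) s t : in_bidisk s t ->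
  carlitz_monomial l mu i f s t = \sum_(j < i.+1)
    ((x - root_x C mu) ^+ (i - j) *+ 'C(i, j)) ^+ (q ^ l) *
    carlitz_monomial l 0 j f s t.
Proof.
move=> st; rewrite carlitz_monomialE iter_ds_Deltat // frob_sum.
by apply: eq_bigr => j _; rewrite exprMn carlitz_monomialE.
Qed.

End CarlitzModule.

(** * Linear independence of the germs *)

Section Independence.
Context (R : realType) (F : finFieldType) (C : completed_closure R F).
Implicit Types (s t : C) (A : nat -> C).

Local Notation q := #|F|.
Local Notation x := (cc_x C).
Local Notation "v[ z ]" := (cc_abs (z : C)) (at level 0, z at level 99, format "v[ z ]").
Local Notation "[' k ]" := (carlitz_bracket C k) (at level 0, k at level 99, format "[' k ]").
Local Notation "u ~> l" := (abs_cvg (@cc_abs R F C) u l) (at level 70).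
Local Notation f := (@carlitz_module R F C).

Lemma poly_infinite_roots (K : idomainType) (P : {poly K}) (u : nat -> K) :
  injective u -> (forall n, P.[u n] = 0) -> P = 0.
Proof.
move=> uI uP; apply/eqP/negPn/negP => P0.
have := @max_poly_roots _ P (map u (iota 0 (size P))) P0 _ _.
rewrite size_map size_iota ltnn map_inj_uniq // iota_uniq => H.
suff : false by []; apply: H => //.
by apply/allP => _ /mapP[n _ ->]; rewrite rootE uP.
Qed.

(** If [A n] is the first nonzero coefficient, the terms at a point [t0] are
    bounded by some [B], and at [t = x^m t0] the later terms are at most
    [B |x|^(m (q^n + 1))].  For large [m] this is smaller than the [n]-th term,
    so that all later partial sums have the absolute value of that term and
    cannot tend to 0. *)
Lemma qpow_series_eq0 A (r : R) : 0 < r ->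
  (forall t, v[t] < r -> (fun n => \sum_(k < n) A k * t ^+ (q ^ k)) ~> 0) ->
  forall n, A n = 0.
Proof.
move=> r0 HA; have x0 := cc_abs_x_gt0 C; have x1 := cc_abs_x_lt1 C.
elim/ltn_ind => n IH; apply/eqP/negPn/negP => An.
have [M HM] := xpow_small C r0.
have small m : v[x ^+ (M + m)] < r by rewrite cc_absX HM ?leq_addr.
set t0 := x ^+ M; pose a k := A k * t0 ^+ (q ^ k).
have t00 : 0 < v[t0] by rewrite cc_absX exprn_gt0.
have [B B1 aB] : exists2 B : R, 0 < B & forall k, v[a k] <= B.
  have /cc_cvgP/(_ 1 ltr01)[N HN] := HA _ (small 0%N).
  rewrite addn0 in HN; exists (1 + \sum_(k < N) v[a k]) => [|k].
    by rewrite ltr_pwDl // sumr_ge0 // => k _; exact: cc_abs_ge0.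
  have [kN|Nk] := ltnP k N.
    rewrite (bigD1 (Ordinal kN)) //= addrCA lerDl addr_ge0 // sumr_ge0 // => j _.
    exact: cc_abs_ge0.
  have -> : a k = \sum_(j < k.+1) a j - \sum_(j < k) a j.
    by rewrite big_ord_recr /= addrAC subrr add0r.
  apply: le_trans (cc_absB _ _) _; rewrite ge_max.
  have ub m : (N <= m)%N -> v[\sum_(j < m) a j] <= 1 + \sum_(k < N) v[a k].
    move=> Nm; apply: le_trans (_ : _ <= 1) _.
      by have := ltW (HN _ Nm); rewrite subr0.
    by rewrite lerDl sumr_ge0 // => j _; exact: cc_abs_ge0.
  by rewrite !ub // leqW.
have an0 : 0 < v[a n] by rewrite cc_absM cc_absX mulr_gt0 ?exprn_gt0 // cc_abs_gt0.
(* The exponent [m] for which the [n]-th term dominates at [x^(M + m)]. *)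
have [m Hm] := xpow_small C (divr_gt0 an0 B1).
have {Hm} := Hm m (leqnn m); rewrite ltr_pdivlMr // => Hm.
pose b k := A k * (x ^+ (M + m)) ^+ (q ^ k).
have bE k : v[b k] = v[a k] * v[x] ^+ (m * q ^ k).
  by rewrite /b exprD exprMn mulrA cc_absM !cc_absX -exprM.
have bn0 : 0 < v[b n] by rewrite bE mulr_gt0 // exprn_gt0.
have /cc_cvgP/(_ _ bn0)[N HN] := HA _ (small m).
have := HN (n.+1 + N)%N (leq_addl _ _); rewrite subr0 -/(b _).
have -> : \sum_(k < n.+1 + N) b k = b n - (- \sum_(i < N) b (n.+1 + i)%N).
  rewrite big_split_ord /= big_ord_recr big1 /= ?add0r ?opprK // => i _.
  by rewrite /b IH ?mul0r.
rewrite cc_absB_lt ?ltxx // cc_absN.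
apply: (@le_lt_trans _ _ (B * v[x] ^+ m * v[x] ^+ (m * q ^ n))).
  apply: cc_abs_sum => [|i _]; first by rewrite !mulr_ge0 ?exprn_ge0 // ltW.
  rewrite bE -mulrA ler_pM ?exprn_ge0 ?cc_abs_ge0 //.
  rewrite -exprD ler_wiXn2l ?cc_abs_ge0 //; first exact: ltW.
  rewrite -mulnS leq_mul2l; apply/orP; right.
  by rewrite ltn_exp2l ?q_gt1 // addSn ltnS leq_addr.
by rewrite bE ltr_pM2r ?exprn_gt0 // mulrC.
Qed.

(** The factor in front of [f_k(s)^(q^l) t^(q^(k+l))] in the combination of the
    [tau^l Delta_t^i f] with coefficients [c l i]. *)
Definition weight (J : nat) (c : nat -> nat -> C) (l k : nat) : C :=
  \sum_(i < J) c l i * ([' k] ^+ i) ^+ (q ^ l).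

(** The coefficient of [t^(q^n)] in that combination. *)
Definition joint_coef (J : nat) (c : nat -> nat -> C) s (n : nat) : C :=
  \sum_(l < J | (l <= n)%N)
    weight J c l (n - l) * carlitz_poly (n - l) s ^+ (q ^ l).

(** Applying [tau^l] moves the [k]-th term to index [k + l]; the shift is
    harmless for each [l] separately. *)
Lemma cvg_joint_series J c s t : in_bidisk s t ->
  (fun n => \sum_(k < n) joint_coef J c s k * t ^+ (q ^ k)) ~>
  (\sum_(l < J) \sum_(i < J) c l i * carlitz_monomial l 0 i f s t).
Proof.
move=> st.
pose u (l n : nat) := \sum_(k < n) (if (l <= k)%N then
  weight J c l (k - l) * carlitz_poly (k - l) s ^+ (q ^ l) * t ^+ (q ^ k) else 0).
have H : (fun n => \sum_(l < J) u l n) ~>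
    (\sum_(l < J) \sum_(i < J) c l i * carlitz_monomial l 0 i f s t).
  apply: cc_cvg_sum => l _; apply/(cc_cvg_shift l).
  have Hl : (fun n => \sum_(i < J) c l i *
      weighted (fun k => [' k] ^+ i) s t n ^+ (q ^ l)) ~>
      (\sum_(i < J) c l i * carlitz_monomial l 0 i f s t).
    apply: cc_cvg_sum => i _; apply: cc_cvgZ; rewrite carlitz_monomialE.
    by apply: cc_cvg_frob; exact: cvg_Deltat.
  apply: cc_cvg_ext Hl => n; rewrite /u addnC big_split_ord /= [X in X + _]big1.
    rewrite add0r /weighted.
    under eq_bigr do rewrite frob_sum mulr_sumr.
    rewrite exchange_big; apply: eq_bigr => k _ /=.
    rewrite leq_addr addKn /weight mulr_suml mulr_suml; apply: eq_bigr => i _.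
    by rewrite !exprMn -(exprM t) -expnD addnC; ring.
  by move=> k _; rewrite leqNgt ltn_ord.
apply: cc_cvg_ext H => n; rewrite /u exchange_big; apply: eq_bigr => k _ /=.
by rewrite -big_mkcond /= mulr_suml.
Qed.

Lemma bracket_inj : injective (fun k => [' k]).
Proof.
move=> m n /addIr /xpow_inj /eqP; rewrite eqn_exp2l ?q_gt1 //.
by move=> /eqP.
Qed.

Lemma frobX_inj l : injective (fun z : C => z ^+ (q ^ l)).
Proof.
elim: l => [|l IH] y z; first by rewrite !expr1.
by rewrite /= expnSr !exprM => /frob_inj /IH.
Qed.

(** By induction on [l], the weights [weight J c l k] vanish for all [k]: in
    the coefficient of [t^(q^(l+k))], the summands with index below [l] are
    zero by induction and those above [l] are divisible by [s^(q^(l+1))], so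
    the coefficient of [s^(q^l)] isolates [weight J c l k]. *)
Lemma carlitz_monomials_free J (c : nat -> nat -> C) (r : R) : 0 < r ->
  (forall s t, v[s] < r -> v[t] < r ->
    \sum_(l < J) \sum_(i < J) c l i * carlitz_monomial l 0 i f s t = 0) ->
  forall l i, (l < J)%N -> (i < J)%N -> c l i = 0.
Proof.
move=> r0 H0; have x2 : 0 < v[x] ^+ 2 by rewrite exprn_gt0 ?cc_abs_x_gt0.
pose r1 := Num.min r (v[x] ^+ 2).
have r10 : 0 < r1 by rewrite lt_min r0.
have jc0 s n : v[s] < r1 -> joint_coef J c s n = 0.
  move=> s1; apply: (qpow_series_eq0 r10) => t t1.
  move: s1 t1; rewrite !lt_min => /andP[sr sx] /andP[tr tx].
  have := cvg_joint_series J c (in_bidisk_small sx tx).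
  by rewrite H0.
have [M HM] := xpow_small C r10.
have small m : v[x ^+ (M + m)] < r1 by rewrite cc_absX HM ?leq_addr.
have /choice[h hP] : forall k, exists h : {poly C}, h.[0] != 0 /\
    forall s, carlitz_poly k s = s * h.[s].
  by move=> k; have [h] := carlitz_poly_factor C k; exists h.
have W0 l : (l < J)%N -> forall k, weight J c l k = 0.
  elim/ltn_ind: l => l IH lJ k.
  pose n := (l + k)%N.
  pose P := \sum_(j < J | (j <= n)%N)
    weight J c j (n - j) *: (('X * h (n - j)%N) ^+ (q ^ j)).
  have P0 : P = 0.
    apply: (@poly_infinite_roots _ _ (fun m => x ^+ (M + m))) => [m m'|m].
      by move=> /xpow_inj /addnI.
    rewrite -[RHS](jc0 (x ^+ (M + m)) n (small m)) horner_sum.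
    apply: eq_bigr => j _; rewrite hornerZ horner_exp hornerM hornerX.
    by rewrite (hP _).2.
  have : P`_(q ^ l) = 0 by rewrite P0 coef0.
  rewrite coef_sum (bigD1 (Ordinal lJ)) /= ?leq_addr // big1 ?addr0; last first.
    move=> j /andP[jn jl]; rewrite coefZ exprMn coefXnM.
    have [jl'|lj|e] := ltngtP (j : nat) l.
    - by rewrite IH ?mul0r.
    - by rewrite ltn_exp2l ?q_gt1 // lj mulr0.
    - by move: jl; rewrite -val_eqE /= e eqxx.
  rewrite coefZ exprMn coefXnM ltnn subnn -horner_coef0 horner_exp.
  rewrite /n addKn => /eqP; rewrite mulf_eq0 expf_eq0 (negbTE (hP k).1) andbF orbF.
  by move/eqP.
move=> l i lJ iJ; pose Q := \poly_(i < J) c l i.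
have : Q`_i = 0.
  suff -> : Q = 0 by rewrite coef0.
  apply: (@poly_infinite_roots _ _ (fun k => [' k] ^+ (q ^ l))) => [k k'|k].
    by move=> /frobX_inj /bracket_inj.
  rewrite horner_poly -[RHS](W0 l lJ k); apply: eq_bigr => j _.
  by rewrite exprAC.
by rewrite coef_poly iJ.
Qed.

End Independence.

(** * The Hilbert polynomial *)

Section HilbertPolynomial.
Context (R : realType) (F : finFieldType) (C : completed_closure R F).
Implicit Types (s t : C) (g : C -> C -> C).

Local Notation q := #|F|.
Local Notation x := (cc_x C).
Local Notation "v[ z ]" := (cc_abs (z : C)) (at level 0, z at level 99, format "v[ z ]").
Local Notation f := (@carlitz_module R F C).

(** The exponents [(l, i)] of the basis [tau^l Delta_t^i f] of the [j]-th term
    of the filtration. *)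
Definition triangle (j : nat) : {set 'I_j.+1 * 'I_j.+1} :=
  [set p : 'I_j.+1 * 'I_j.+1 | (p.1 + p.2 <= j)%N].

(** The pairs with first entry [l] number [j - l + 1]. *)
Lemma card_triangle j : (#|triangle j| * 2 = j.+1 * j.+2)%N.
Proof.
have -> : #|triangle j| = (\sum_(l < j.+1) l.+1)%N.
  rewrite -sum1_card.
  rewrite (eq_bigl (fun p : 'I_j.+1 * 'I_j.+1 => true && (p.1 + p.2 <= j)%N)) => [|p].
    2: by rewrite inE.
  rewrite -(pair_big_dep xpredT (fun l i : 'I_j.+1 => (l + i <= j)%N)
    (fun _ _ => 1%N)) /=.
  rewrite (reindex_inj rev_ord_inj); apply: eq_bigr => l _ /=.
  rewrite (eq_bigl (fun i : 'I_j.+1 => (i < l.+1)%N)) => [|i].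
    by rewrite -(big_ord_widen _ (fun=> 1%N)) // sum_nat_const card_ord muln1.
  by have := ltn_ord l; have := ltn_ord i; rewrite subSS ltnS; lia.
elim: (j.+1) => [|n IH]; first by rewrite big_ord0.
by rewrite big_ord_recr /= mulnDl IH; lia.
Qed.

Definition basis_germ j (a : 'I_#|triangle j|) : C -> C -> C :=
  carlitz_monomial (enum_val a).1 0 (enum_val a).2 f.

Lemma basis_germ_filtration j (a : 'I_#|triangle j|) :
  filtration f j (basis_germ a).
Proof.
have := enum_valP a; rewrite inE => aj.
pose p := enum_val a.
exists (fun l mu i : nat => [&& l == p.1 :> nat, mu == 0 & i == p.2 :> nat]%N%:R), 1 => // s t _ _.
rewrite (bigD1 p.1) //= [X in _ + X]big1 ?addr0 => [|l]; last first.
  rewrite -val_eqE /= => /negbTE lp; rewrite big1 // => mu _; rewrite big1 // => i _.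
  by rewrite lp mul0r.
rewrite (bigD1 ord0) //= [X in _ + X]big1 ?addr0 => [|mu]; last first.
  rewrite -val_eqE /= => /negbTE mu0; rewrite big1 // => i _.
  by rewrite mu0 andbF mul0r.
rewrite (bigD1 p.2) /= ?addn0 // [X in _ + X]big1 ?addr0 => [|i].
  by rewrite !eqxx mul1r.
by rewrite -val_eqE /= => /andP[_ /negbTE ip]; rewrite ip !andbF mul0r.
Qed.

(** A relation between basis germs is one between all [tau^l Delta_t^i f] with
    [l, i <= j], the coefficients off the triangle being zero. *)
Lemma basis_germ_free j (c : 'I_#|triangle j| -> C) :
  germ_eq (fun s t => \sum_(a < #|triangle j|) c a * basis_germ a s t)
    (fun _ _ => 0) ->
  forall a, c a = 0.
Proof.
move=> [r r0 H] a.
pose c' l i := \sum_(b < #|triangle j| | enum_val b == (inord l, inord i)) c b.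
have c'E : c' (enum_val a).1 (enum_val a).2 = c a.
  rewrite /c' !inord_val -surjective_pairing (eq_bigl (pred1 a)) ?big_pred1_eq //.
  by move=> b; rewrite /= (inj_eq enum_val_inj).
rewrite -c'E; apply: (carlitz_monomials_free (J := j.+1) r0) => // s t sr tr.
rewrite -[RHS](H s t sr tr) pair_big /=.
rewrite [RHS](partition_big (@enum_val _ (triangle j)) xpredT) //=.
apply: eq_bigr => p _; rewrite /c' !inord_val -surjective_pairing mulr_suml.
by apply: eq_bigr => b /eqP <-.
Qed.

(** Expanding the powers of [d_s] keeps [l] and does not increase [i], so the
    result stays in the triangle. *)
Lemma basis_germ_span j g : filtration f j g ->
  exists c : 'I_#|triangle j| -> C,
    germ_eq g (fun s t => \sum_(a < #|triangle j|) c a * basis_germ a s t).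
Proof.
move=> [c [r r0 gE]].
pose e (l mu i k : nat) : C := ((x - root_x C mu) ^+ (i - k) *+ 'C(i, k)) ^+ (q ^ l).
pose c' (l k : nat) := \sum_(mu < j.+1) \sum_(i < j.+1 | (l + mu + i <= j)%N)
  (if (k < i.+1)%N then c l mu i * e l mu i k else 0).
exists (fun a : 'I_#|triangle j| => c' (enum_val a).1 (enum_val a).2).
exists (Num.min r (v[x] ^+ 2)).
  by rewrite lt_min r0 exprn_gt0 ?cc_abs_x_gt0.
move=> s t; rewrite !lt_min => /andP[sr sx] /andP[tr tx].
have st := in_bidisk_small sx tx.
rewrite gE //; transitivity (\sum_(p in triangle j)
    c' p.1 p.2 * carlitz_monomial p.1 0 p.2 f s t); last by rewrite big_enum_val.
rewrite [RHS]big_mkcond /=.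
transitivity (\sum_(l < j.+1) \sum_(k < j.+1) c' l k * carlitz_monomial l 0 k f s t).
  apply: eq_bigr => l _; under [RHS]eq_bigr do rewrite mulr_suml.
  rewrite exchange_big; apply: eq_bigr => mu _ /=.
  under [RHS]eq_bigr do rewrite mulr_suml.
  rewrite exchange_big; apply: eq_bigr => i _ /=.
  rewrite carlitz_monomial_expand // mulr_sumr.
  rewrite (big_ord_widen j.+1 (fun k => c l mu i *
    (e l mu i k * carlitz_monomial l 0 k f s t))) // big_mkcond /=.
  by apply: eq_bigr => k _; case: ifP => _; rewrite ?mul0r // mulrA.
rewrite pair_big /=; apply: eq_bigr => p _; rewrite inE.
case: ifPn => // pj; rewrite /c' big1 ?mul0r // => mu _; rewrite big1 // => i ij.
by case: ifP => // pi; exfalso; move: pj ij pi; lia.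
Qed.

Lemma carlitz_module_neq0 : ~ germ_eq f (fun _ _ => 0).
Proof.
move=> [r r0 H].
have /eqP : (1 : C) = 0; last by rewrite oner_eq0.
apply: (@carlitz_monomials_free _ _ C 1 (fun _ _ => 1) r r0 _ 0 0) => // s t sr tr.
by rewrite !big_ord1 mul1r; exact: H.
Qed.

Lemma carlitz_module_dim : module_dim f 2.
Proof.
pose chi : {poly rat} := 2^-1 *: (('X + 1%:P) * ('X + 2%:P)).
exists chi; last first.
  rewrite size_scale // size_mul ?monic_neq0 ?monicXaddC //.
  by rewrite !size_XaddC.
near=> j; exists #|triangle j|.
  exists (@basis_germ j); split; first exact: basis_germ_filtration.
    exact: basis_germ_free.
  exact: basis_germ_span.
have /(congr1 (fun n => n%:R : rat)) := card_triangle j.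
rewrite !natrM -!natr1 /chi hornerZ hornerM !hornerD !hornerX !hornerC => e.
by apply: (mulIf (_ : (2 : rat) != 0)) => //; rewrite e; field.
Unshelve. all: by end_near.
Qed.

End HilbertPolynomial.

Theorem mainTheorem4 (R : realType) (F : finFieldType)
    (C : completed_closure R F) :
  in_F2 (@carlitz_module R F C) /\ quasi_holonomic (@carlitz_module R F C).
Proof.
have F2 := carlitz_module_F2 C; split=> //; split=> //.
  exact: carlitz_module_neq0.
exact: carlitz_module_dim.
Qed.
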